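(* Let $d \in \mathbb{N}^*$ and $\mathbf{T}=(T_1,\dots,T_d)\in \mathcal{B}(\mathcal{H})^d$. Then the following assertions are equivalent: (i) $JtW_q(\mathbf{T})$ is convex; (ii) $\mathbf{Sp}\{T_1,\dots,T_d\}$ is generated (as a vector space) by a family $\{R_1,\dots,R_n\}$ ($n\in\mathbb{N}^*$) such that $JtW_q(R_1,\dots,R_n)$ is convex; (iii) for each $m\in\mathbb{N}^*$ and all $S_1,\dots,S_m \in \mathbf{Sp}\{T_1,\dots,T_d\}$, the set $JtW_q(S_1,\dots,S_m)$ is convex.
   Context: $\mathbb{N}^*$ is the set of positive integers. $\mathcal{H}$ is a complex Hilbert space with $\dim\mathcal{H}\ge 2$, $\mathcal{B}(\mathcal{H})$ is the algebra of bounded linear operators on $\mathcal{H}$, and $q\in\mathbb{C}$ is fixed with $|q|\le 1$. $\mathbf{Sp}\,M$ denotes the complex linear span of a set $M$ of operators. Put $\mathbb{S}_q(\mathcal{H})=\{(x,y)\in\mathcal{H}\times\mathcal{H}: \|x\|=\|y\|=1,\ \langle x,y\rangle=q\}$. The joint $q$-numerical range of a tuple $\mathbf{T}=(T_1,\dots,T_d)$ is $JtW_q(\mathbf{T})=\{(\langle T_1x,y\rangle,\dots,\langle T_dx,y\rangle)\in\mathbb{C}^d : (x,y)\in\mathbb{S}_q(\mathcal{H})\}$. *)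

(* Defs.v *)
From HB Require Import structures.
From mathcomp Require Import all_boot all_order all_algebra.
From mathcomp Require Import sesquilinear complex.
From mathcomp Require Import all_classical all_reals all_analysis.

Set Implicit Arguments.
Unset Strict Implicit.
Unset Printing Implicit Defensive.

Import Order.TTheory GRing.Theory Num.Theory.
Import numFieldNormedType.Exports.

Local Open Scope classical_set_scope.
Local Open Scope complex_scope.
Local Open Scope ring_scope.

(* [inner] is linear in its first argument and conjugate-linear in its
   second; the last axiom makes the ambient norm (valued in R[i], like every
   MathComp norm over R[i]) the one induced by the inner product. *)
HB.mixin Record CompleteNormedModule_isHilbert (R : realType) H
    & CompleteNormedModule R[i] H := {
  inner : {dot H for (@Num.conj R[i])} ;
  inner_norm : forall x : H, inner x x = `|x| ^+ 2
}.

#[short(type="hilbertType")]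
HB.structure Definition Hilbert (R : realType) :=
  {H of CompleteNormedModule R[i] H & CompleteNormedModule_isHilbert R H}.

Section LinearAlgebra.
Context {K : fieldType} {V : lmodType K}.

Definition lin_indep n (v : 'I_n -> V) : Prop :=
  forall c : 'I_n -> K, \sum_i c i *: v i = 0 -> forall i, c i = 0.

Definition lspan (M : set V) : set V :=
  [set v | exists n (c : 'I_n -> K) (w : 'I_n -> V),
     (forall i, M (w i)) /\ v = \sum_i c i *: w i].

End LinearAlgebra.

(* V may be infinite-dimensional. *)
Definition dim_ge {K : fieldType} (V : lmodType K) (n : nat) : Prop :=
  exists v : 'I_n -> V, lin_indep v.

Section BoundedOperators.
Context {R : realType} (H : hilbertType R).

(* The bound M is necessarily real as soon as H <> 0: the order on R[i] only
   compares numbers with the same imaginary part. *)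
Definition is_bounded_op (f : H -> H) : Prop :=
  linear f /\ exists M : R[i], forall x, `|f x| <= M * `|x|.

Definition bounded_op_pred : {pred H -> H} := fun f => `[< is_bounded_op f >].

Lemma bounded_op_submod_closed : submod_closed bounded_op_pred.
Proof.
split.
  apply/asboolP; split; first by move=> a x y /=; rewrite scaler0 addr0.
  by exists 0 => x /=; rewrite normr0 mul0r.
move=> a f g /asboolP[lf [M fM]] /asboolP[lg [N gN]]; apply/asboolP; split.
  move=> b x y /=.
  rewrite -[LHS]/(a *: f (b *: x + y) + g (b *: x + y)).
  rewrite -[RHS]/(b *: (a *: f x + g x) + (a *: f y + g y)).
  by rewrite lf lg !scalerDr !scalerA [a * b]mulrC addrACA.
exists (`|a| * M + N) => x; rewrite -[f in `|f|]/(a *: f x + g x) mulrDl.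
rewrite (le_trans (ler_normD _ _))// lerD// normrZ -mulrA ler_wpM2l//.
Qed.

HB.instance Definition _ :=
  GRing.isSubmodClosed.Build R[i] (H -> H) bounded_op_pred
    bounded_op_submod_closed.

Record bounded_op : Type := BoundedOp {
  bounded_op_fun :> H -> H;
  bounded_op_funP : bounded_op_fun \in bounded_op_pred
}.

HB.instance Definition _ := [isSub for bounded_op_fun].
HB.instance Definition _ := [Choice of bounded_op by <:].
HB.instance Definition _ := [SubChoice_isSubLmodule of bounded_op by <:].

End BoundedOperators.

Section JointNumericalRange.
Context {R : realType} {H : hilbertType R}.

Definition Sq (q : R[i]) : set (H * H) :=
  [set p | [/\ `|p.1| = 1, `|p.2| = 1 & inner p.1 p.2 = q]].

Definition JtW (q : R[i]) d (T : 'I_d -> bounded_op H) : set 'rV[R[i]]_d :=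
  [set \row_j inner (T j p.1) p.2 | p in Sq q].

End JointNumericalRange.

(* [convex_set] over the R[i]-module 'rV[R[i]]_d is usual (real) convexity: its
   weights are the t in R[i] with 0 <= t <= 1, and for the order on R[i] these
   are exactly the reals of the unit interval. *)
Definition convexC {R : realType} d (A : set 'rV[R[i]]_d) : Prop :=
  convex_set (M := 'rV[R[i]]_d) A.

(* Main.v *)
Require Import Defs.
From mathcomp Require Import all_boot all_order all_algebra.
From mathcomp Require Import sesquilinear complex.
From mathcomp Require Import all_classical all_reals all_analysis.

Set Implicit Arguments.
Unset Strict Implicit.
Unset Printing Implicit Defensive.

Local Open Scope classical_set_scope.
Local Open Scope complex_scope.
Local Open Scope ring_scope.

(** If every operator of a tuple [U] is a linear combination of the operators
    of a tuple [S], then, [inner] being linear on the left, the point of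
    [JtW q U] given by a pair [(x, y)] is the image of the point of [JtW q S]
    given by the same pair, under a linear map that does not depend on the
    pair: right multiplication by the matrix of coefficients.  Hence [JtW q U]
    is a linear image of [JtW q S] ([JtW_lincomb]), and it is convex as soon
    as [JtW q S] is ([convex_set_image_linear]).

    Convexity of the joint range therefore passes from a tuple to every tuple
    in its span ([convexC_JtW_lspan]).  Any generating tuple of the span of
    [T] can serve as [S], which gives the third assertion from the second;
    the other two implications are the instances where the tuple is [T]
    itself. *)

Lemma lspan_range (K : fieldType) (V : lmodType K) n (S : 'I_n -> V) (v : V) :
  lspan (range S) v -> exists c : 'I_n -> K, v = \sum_k c k *: S k.
Proof.
move=> [l [c [w [wS ->]]]].
have /choice[f fS] i : exists k, S k = w i by have [k _ <-] := wS i; exists k.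
(* [f] may send several indices to the same [k]: their coefficients add up. *)
exists (fun k => \sum_(i | f i == k) c i).
rewrite (partition_big f xpredT)//=; apply: eq_bigr => k _.
by rewrite GRing.scaler_suml; apply: eq_bigr => i /eqP <-; rewrite fS.
Qed.

Lemma sub_lspan (K : fieldType) (V : lmodType K) (M : set V) : M `<=` lspan M.
Proof.
move=> v Mv; exists 1%N, (fun=> 1), (fun=> v); split=> //.
by rewrite big_ord1 GRing.scale1r.
Qed.

Lemma convex_set_image_linear (K : numDomainType) (M N : lmodType K)
    (f : {linear M -> N}) (A : set M) :
  convex_set (M := M) A -> convex_set (M := N) (f @` A).
Proof.
move=> cA _ _ t /set_mem[x Ax <-] /set_mem[y Ay <-]; apply/mem_set.
exists (conv t (x : convex_lmodType M) y).
  by apply/set_mem/cA; exact/mem_set.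
(* [conv] on a module unfolds to [t *: x + (1 - t) *: y]. *)
rewrite -[LHS]/(f (_ *: (x : M) + _ *: (y : M))).
by rewrite GRing.linearD !GRing.linearZ.
Qed.

Section JointRange.
Context (R : realType) (H : hilbertType R).

Lemma bounded_op_sumE (I : Type) (r : seq I) (c : I -> R[i])
    (S : I -> bounded_op H) (x : H) :
  (\sum_(k <- r) c k *: S k) x = \sum_(k <- r) c k *: S k x.
Proof. by elim/big_rec2: _ => // k y F _ <-. Qed.

(** One and the same pair [p] in [Sq q] produces corresponding points of the two
    ranges, so the ranges are related as sets by a single linear map; the
    transposed indexing of [A] makes it act on row vectors from the right. *)
Lemma JtW_lincomb (q : R[i]) n m (S : 'I_n -> bounded_op H)
    (U : 'I_m -> bounded_op H) (A : 'M[R[i]]_(n, m)) :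
  (forall j, U j = \sum_k A k j *: S k) -> JtW q U = mulmxr A @` JtW q S.
Proof.
move=> US; rewrite /JtW image_comp; apply: eq_imagel => p _ /=.
apply/rowP => j; rewrite !mxE US bounded_op_sumE linear_sumlz.
by apply: eq_bigr => k _; rewrite linearZl_LR mxE GRing.mulrC.
Qed.

(** The tuple [S] may be linearly dependent: any choice of coefficients
    expressing [U] through [S] gives a matrix with the required image. *)
Lemma convexC_JtW_lspan (q : R[i]) n m (S : 'I_n -> bounded_op H)
    (U : 'I_m -> bounded_op H) :
  (forall j, lspan (range S) (U j)) ->
  convexC (JtW q S) -> convexC (JtW q U).
Proof.
move=> US; have /choice[c Uc] j := lspan_range (US j).
rewrite (@JtW_lincomb _ _ _ S U (\matrix_(k, j) c j k)).
  exact: convex_set_image_linear.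
by move=> j; rewrite Uc; apply: eq_bigr => k _; rewrite mxE.
Qed.

End JointRange.

Theorem theorem4 (R : realType) (H : hilbertType R) (hH : dim_ge H 2)
    (q : R[i]) (hq : `|q| <= 1)
    (d : nat) (hd : (0 < d)%N) (T : 'I_d -> bounded_op H) :
  [<-> convexC (JtW q T);
       exists n (S : 'I_n -> bounded_op H),
         [/\ (0 < n)%N, lspan (range S) = lspan (range T)
           & convexC (JtW q S)];
       forall m (S : 'I_m -> bounded_op H), (0 < m)%N ->
         (forall j, lspan (range T) (S j)) -> convexC (JtW q S)].
Proof.
tfae => [cT | [n [S [_ ST cS]]] m U _ UT | cspan].
- by exists d, T.
- by apply: convexC_JtW_lspan cS => j; rewrite ST.
- by apply: cspan => // j; apply: sub_lspan; exists j.
Qed.
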